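(* Let $(A,L)$ be a Lie--Rinehart algebra with a divergence operator $\operatorname{div}$ and corresponding BV operator $\Delta$ on $\Lambda_A^\bullet L$. Let $\Pi\in\Lambda_A^2L$ satisfy $[\Pi,\Pi]=0$, and put $\partial_\Pi=[\Pi,-]$ and $X_\Delta:=\Delta(\Pi)\in L$. Then $$\Delta\,\partial_\Pi+\partial_\Pi\,\Delta=[X_\Delta,-]$$ as operators on $\Lambda_A^\bullet L$. In particular, if $\Pi$ is the bivector of a Poisson structure on a smooth manifold $M$ (with $A=C^\infty(M)$, $L=\mathfrak X(M)$, and a chosen divergence operator), then the derivation $\Delta\partial_\Pi+\partial_\Pi\Delta$ of the algebra of multivector fields is $[X_\Delta,-]$, where $X_\Delta$ is the modular vector field $f\mapsto\operatorname{div}(\{f,-\})$, whose class is the modular class of the Poisson structure.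
   Context: Let $k$ be a field. A Lie--Rinehart algebra $(A,L)$ consists of a commutative $k$-algebra $A$, a $k$-Lie algebra $L$ that is also an $A$-module, and an $A$-linear Lie algebra map (anchor) $L\to\operatorname{Der}_k(A)$, $X\mapsto(a\mapsto X(a))$, such that $[X,fY]=f[X,Y]+X(f)Y$. The exterior algebra $\Lambda_A^\bullet L$ is a Gerstenhaber algebra: it is graded-commutative, and has a unique bracket of degree $-1$ which is a super Lie bracket on the shift by one, satisfies $[a,bc]=[a,b]c+(-1)^{(|a|-1)|b|}b[a,c]$, extends the bracket of $L$, and satisfies $[X,f]=X(f)$ for $X\in L$, $f\in A$ (and $[f,g]=0$ for $f,g\in A$). A divergence operator is an additive map $\operatorname{div}:L\to A$ with $\operatorname{div}[X,Y]=X(\operatorname{div}Y)-Y(\operatorname{div}X)$ and $\operatorname{div}(aX)=a\operatorname{div}X+X(a)$. The corresponding BV operator is $$\Delta(X_1\wedge\cdots\wedge X_n)=\sum_{i<j}(-1)^{i+j}[X_i,X_j]\wedge X_1\wedge\cdots\widehat{X_i}\cdots\widehat{X_j}\cdots\wedge X_n+\sum_{i=1}^n(-1)^i\operatorname{div}(X_i)X_1\wedge\cdots\widehat{X_i}\cdots\wedge X_n,$$ which satisfies $\Delta^2=0$ and generates the bracket: $[a,b]=(-1)^{|a|}\Delta(ab)-(-1)^{|a|}\Delta(a)b-a\Delta(b)$. A Poisson structure on $M$ is given by a bivector $\Pi$ with $[\Pi,\Pi]=0$, where $\{f,g\}=\Pi(df,dg)$, with the convention $(X\wedge Y)(df,dg)=X(f)Y(g)-Y(f)X(g)$.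 Its modular class is the class in the degree-one cohomology of $(\Lambda^\bullet_{C^\infty(M)}\mathfrak X(M),\partial_\Pi)$ of the vector field $f\mapsto\operatorname{div}(\{f,-\})$. *)

(* Defs.v *)
From HB Require Import structures.
From mathcomp Require Import all_boot all_order all_algebra.
From mathcomp Require Import generic_quotient.
From mathcomp Require Import ring.
From mathcomp Require Import mathcomp_extra boolp classical_sets functions.
From mathcomp Require Import reals topology normedtype derive.

Set Implicit Arguments.
Unset Strict Implicit.
Unset Printing Implicit Defensive.

Import Order.TTheory GRing.Theory Num.Theory.
Import numFieldNormedType.Exports.

Local Open Scope classical_set_scope.
Local Open Scope ring_scope.
Local Open Scope quotient_scope.

(** * Exterior algebra of a module over a commutative ring

   [ext M] is the associative unital [R]-algebra generated by the elements of
   [M], subject to the module relations of [M] and to [x * x = 0].  It is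
   built as the quotient of formal expressions by the congruence generated by
   these relations; [ext_lift] below is its universal property.  Rings of
   type [pzRingType] may be zero, which is why the [algType] structures of the
   library (whose rings are nonzero) are not used. *)

Section ExtTerm.
Context {R : comPzRingType} (M : lmodType R).

Inductive ext_term : Type :=
| EScal of R
| EVec of M
| EAdd of ext_term & ext_term
| EMul of ext_term & ext_term.

HB.instance Definition _ := gen_eqMixin ext_term.
HB.instance Definition _ := gen_choiceMixin ext_term.

Inductive ext_rel : ext_term -> ext_term -> Prop :=
| ext_rel_refl t : ext_rel t t
| ext_rel_sym t u : ext_rel t u -> ext_rel u t
| ext_rel_trans t u v : ext_rel t u -> ext_rel u v -> ext_rel t v
| ext_rel_add t t' u u' :
    ext_rel t t' -> ext_rel u u' -> ext_rel (EAdd t u) (EAdd t' u')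
| ext_rel_mul t t' u u' :
    ext_rel t t' -> ext_rel u u' -> ext_rel (EMul t u) (EMul t' u')
| ext_rel_addA t u v : ext_rel (EAdd t (EAdd u v)) (EAdd (EAdd t u) v)
| ext_rel_addC t u : ext_rel (EAdd t u) (EAdd u t)
| ext_rel_add0 t : ext_rel (EAdd (EScal 0) t) t
| ext_rel_addN t : ext_rel (EAdd (EMul (EScal (- 1)) t) t) (EScal 0)
| ext_rel_mulA t u v : ext_rel (EMul t (EMul u v)) (EMul (EMul t u) v)
| ext_rel_mul1l t : ext_rel (EMul (EScal 1) t) t
| ext_rel_mul1r t : ext_rel (EMul t (EScal 1)) t
| ext_rel_mulDl t u v :
    ext_rel (EMul (EAdd t u) v) (EAdd (EMul t v) (EMul u v))
| ext_rel_mulDr t u v :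
    ext_rel (EMul t (EAdd u v)) (EAdd (EMul t u) (EMul t v))
| ext_rel_scalD a b : ext_rel (EScal (a + b)) (EAdd (EScal a) (EScal b))
| ext_rel_scalM a b : ext_rel (EScal (a * b)) (EMul (EScal a) (EScal b))
| ext_rel_scalC a t : ext_rel (EMul t (EScal a)) (EMul (EScal a) t)
| ext_rel_vecD x y : ext_rel (EVec (x + y)) (EAdd (EVec x) (EVec y))
| ext_rel_vecZ a x : ext_rel (EVec (a *: x)) (EMul (EScal a) (EVec x))
| ext_rel_alt x : ext_rel (EMul (EVec x) (EVec x)) (EScal 0).

Definition ext_relb (t u : ext_term) : bool := `[< ext_rel t u >].

Lemma ext_relb_equiv : equiv_class_of ext_relb.
Proof.
split=> [t|t u|u t v].
- by apply/asboolP; apply: ext_rel_refl.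
- by apply/asboolP/asboolP; apply: ext_rel_sym.
- by move=> /asboolP tu /asboolP uv; apply/asboolP; apply: ext_rel_trans tu uv.
Qed.

Canonical ext_relb_equiv_rel := EquivRelPack ext_relb_equiv.

Definition ext := {eq_quot ext_relb}.

HB.instance Definition _ := Choice.on ext.
HB.instance Definition _ := EqQuotient.on ext.

Lemma ext_eqP t u : reflect (\pi_ext t = \pi_ext u) `[< ext_rel t u >].
Proof. exact: eqmodP. Qed.

Lemma ext_relP t u : ext_rel t u -> \pi_ext t = \pi_ext u.
Proof. by move=> tu; apply/ext_eqP/asboolP. Qed.

Lemma ext_relE t u : \pi_ext t = \pi_ext u -> ext_rel t u.
Proof. by move=> /ext_eqP/asboolP. Qed.

Lemma ext_repr_rel t : ext_rel (repr (\pi_ext t)) t.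
Proof. by apply: ext_relE; rewrite reprK. Qed.

Lemma ext_ind (P : ext -> Prop) : (forall t, P (\pi_ext t)) -> forall w, P w.
Proof. by move=> HP w; rewrite -[w]reprK; apply: HP. Qed.

Definition ext_add (u v : ext) : ext := \pi_ext (EAdd (repr u) (repr v)).
Definition ext_mul (u v : ext) : ext := \pi_ext (EMul (repr u) (repr v)).
Definition ext_scal (a : R) : ext := \pi_ext (EScal a).
Definition ext_opp (u : ext) : ext := ext_mul (ext_scal (- 1)) u.

Lemma ext_addE t u : ext_add (\pi_ext t) (\pi_ext u) = \pi_ext (EAdd t u).
Proof. by apply/ext_relP/ext_rel_add; apply: ext_repr_rel. Qed.

Lemma ext_mulE t u : ext_mul (\pi_ext t) (\pi_ext u) = \pi_ext (EMul t u).
Proof. by apply/ext_relP/ext_rel_mul; apply: ext_repr_rel. Qed.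

Lemma ext_addA : associative ext_add.
Proof.
elim/ext_ind=> t; elim/ext_ind=> u; elim/ext_ind=> v.
by rewrite !ext_addE; apply/ext_relP/ext_rel_addA.
Qed.

Lemma ext_addC : commutative ext_add.
Proof.
elim/ext_ind=> t; elim/ext_ind=> u.
by rewrite !ext_addE; apply/ext_relP/ext_rel_addC.
Qed.

Lemma ext_add0 : left_id (ext_scal 0) ext_add.
Proof.
by elim/ext_ind=> t; rewrite ext_addE; apply/ext_relP/ext_rel_add0.
Qed.

Lemma ext_addN : left_inverse (ext_scal 0) ext_opp ext_add.
Proof.
elim/ext_ind=> t; rewrite /ext_opp ext_mulE ext_addE.
by apply/ext_relP/ext_rel_addN.
Qed.

HB.instance Definition _ :=
  GRing.isZmodule.Build ext ext_addA ext_addC ext_add0 ext_addN.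

Lemma ext_mulA : associative ext_mul.
Proof.
elim/ext_ind=> t; elim/ext_ind=> u; elim/ext_ind=> v.
by rewrite !ext_mulE; apply/ext_relP/ext_rel_mulA.
Qed.

Lemma ext_mul1l : left_id (ext_scal 1) ext_mul.
Proof.
by elim/ext_ind=> t; rewrite ext_mulE; apply/ext_relP/ext_rel_mul1l.
Qed.

Lemma ext_mul1r : right_id (ext_scal 1) ext_mul.
Proof.
by elim/ext_ind=> t; rewrite ext_mulE; apply/ext_relP/ext_rel_mul1r.
Qed.

Lemma ext_mulDl : left_distributive ext_mul +%R.
Proof.
elim/ext_ind=> t; elim/ext_ind=> u; elim/ext_ind=> v.
rewrite /GRing.add /= !(ext_addE, ext_mulE).
by apply/ext_relP/ext_rel_mulDl.
Qed.

Lemma ext_mulDr : right_distributive ext_mul +%R.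
Proof.
elim/ext_ind=> t; elim/ext_ind=> u; elim/ext_ind=> v.
rewrite /GRing.add /= !(ext_addE, ext_mulE).
by apply/ext_relP/ext_rel_mulDr.
Qed.

HB.instance Definition _ :=
  GRing.Zmodule_isPzRing.Build ext ext_mulA ext_mul1l ext_mul1r
    ext_mulDl ext_mulDr.

Lemma ext_piD t u : \pi_ext (EAdd t u) = \pi_ext t + \pi_ext u.
Proof. by rewrite -ext_addE. Qed.

Lemma ext_piM t u : \pi_ext (EMul t u) = \pi_ext t * \pi_ext u.
Proof. by rewrite -ext_mulE. Qed.

Lemma ext_scalD a b : ext_scal (a + b) = ext_scal a + ext_scal b.
Proof.
by rewrite /GRing.add /= ext_addE; apply/ext_relP/ext_rel_scalD.
Qed.

Lemma ext_scalM a b : ext_scal (a * b) = ext_scal a * ext_scal b.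
Proof.
by rewrite /GRing.mul /= ext_mulE; apply/ext_relP/ext_rel_scalM.
Qed.

Lemma ext_scalC a w : w * ext_scal a = ext_scal a * w.
Proof.
elim/ext_ind: w => t.
by rewrite /GRing.mul /= !ext_mulE; apply/ext_relP/ext_rel_scalC.
Qed.

Definition ext_scale (a : R) (w : ext) : ext := ext_scal a * w.

Lemma ext_scaleA a b w : ext_scale a (ext_scale b w) = ext_scale (a * b) w.
Proof. by rewrite /ext_scale ext_scalM mulrA. Qed.

Lemma ext_scale1 : left_id 1 ext_scale.
Proof. by move=> w; rewrite /ext_scale [ext_scal 1](_ : _ = 1) ?mul1r. Qed.

Lemma ext_scaleDr : right_distributive ext_scale +%R.
Proof. by move=> a u v; rewrite /ext_scale mulrDr. Qed.

Lemma ext_scaleDl w : {morph ext_scale^~ w : a b / a + b}.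
Proof. by move=> a b; rewrite /ext_scale ext_scalD mulrDl. Qed.

HB.instance Definition _ :=
  GRing.Zmodule_isLmodule.Build R ext ext_scaleA ext_scale1
    ext_scaleDr ext_scaleDl.

Lemma ext_scalE a : ext_scal a = a *: (1 : ext).
Proof. by rewrite /GRing.scale /= /ext_scale mulr1. Qed.

Lemma ext_scaleAl a (u v : ext) : a *: (u * v) = (a *: u) * v.
Proof. by rewrite /GRing.scale /= /ext_scale mulrA. Qed.

Lemma ext_scaleAr a (u v : ext) : a *: (u * v) = u * (a *: v).
Proof. by rewrite /GRing.scale /= /ext_scale !mulrA ext_scalC. Qed.

Definition ext_in (x : M) : ext := \pi_ext (EVec x).

Lemma ext_inD x y : ext_in (x + y) = ext_in x + ext_in y.
Proof. by rewrite /GRing.add /= ext_addE; apply/ext_relP/ext_rel_vecD. Qed.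

Lemma ext_inZ a x : ext_in (a *: x) = a *: ext_in x.
Proof.
rewrite [RHS]/GRing.scale /= /ext_scale [RHS]/GRing.mul /= ext_mulE.
exact/ext_relP/ext_rel_vecZ.
Qed.

Lemma ext_in_linear : linear ext_in.
Proof. by move=> a x y; rewrite ext_inD ext_inZ. Qed.

HB.instance Definition _ := GRing.isLinear.Build R M ext *:%R ext_in ext_in_linear.

Lemma ext_alt x : ext_in x * ext_in x = 0.
Proof. by rewrite /GRing.mul /= ext_mulE; apply/ext_relP/ext_rel_alt. Qed.

End ExtTerm.

Arguments ext_scal {R M}.

Section ExtLift.
Context {R : comPzRingType} (M : lmodType R) (B : pzRingType).
Variables (c : {rmorphism R -> B}) (f : M -> B).
Hypothesis fD : forall x y, f (x + y) = f x + f y.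
Hypothesis c_central : forall a b, b * c a = c a * b.
Hypothesis fZ : forall a x, f (a *: x) = c a * f x.
Hypothesis f_alt : forall x, f x * f x = 0.

Fixpoint ext_eval (t : ext_term M) : B :=
  match t with
  | EScal a => c a
  | EVec x => f x
  | EAdd t u => ext_eval t + ext_eval u
  | EMul t u => ext_eval t * ext_eval u
  end.

Lemma ext_evalP t u : ext_rel t u -> ext_eval t = ext_eval u.
Proof.
elim=> {t u} //=; try by [move=> *; congruence].
- by move=> t u v; rewrite addrA.
- by move=> t u; rewrite addrC.
- by move=> t; rewrite rmorph0 add0r.
- by move=> t; rewrite rmorphN rmorph1 mulN1r addNr rmorph0.
- by move=> t u v; rewrite mulrA.
- by move=> t; rewrite rmorph1 mul1r.
- by move=> t; rewrite rmorph1 mulr1.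
- by move=> t u v; rewrite mulrDl.
- by move=> t u v; rewrite mulrDr.
- by move=> a b; rewrite rmorphD.
- by move=> a b; rewrite rmorphM.
- by move=> x; rewrite f_alt rmorph0.
Qed.

Definition ext_lift (w : ext M) : B := ext_eval (repr w).

Lemma ext_liftE t : ext_lift (\pi_(ext M) t) = ext_eval t.
Proof. exact/ext_evalP/ext_repr_rel. Qed.

Lemma ext_liftD u v : ext_lift (u + v) = ext_lift u + ext_lift v.
Proof.
elim/(@ext_ind R M): u => t; elim/(@ext_ind R M): v => u.
by rewrite -ext_piD !ext_liftE.
Qed.

Lemma ext_liftM u v : ext_lift (u * v) = ext_lift u * ext_lift v.
Proof.
elim/(@ext_ind R M): u => t; elim/(@ext_ind R M): v => u.
by rewrite -ext_piM !ext_liftE.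
Qed.

Lemma ext_lift_scal a : ext_lift (ext_scal a) = c a.
Proof. by rewrite ext_liftE. Qed.

Lemma ext_lift1 : ext_lift 1 = 1.
Proof. by rewrite -[1 in LHS]scale1r -ext_scalE ext_lift_scal rmorph1. Qed.

Lemma ext_liftZ a w : ext_lift (a *: w) = c a * ext_lift w.
Proof. by rewrite -[w in LHS]mul1r ext_scaleAl -ext_scalE ext_liftM ext_lift_scal. Qed.

Lemma ext_lift0 : ext_lift 0 = 0.
Proof. by apply: (addrI (ext_lift 0)); rewrite -ext_liftD !addr0. Qed.

Lemma ext_lift_in x : ext_lift (ext_in x) = f x.
Proof. by rewrite ext_liftE. Qed.

End ExtLift.

Section ExtGrading.
Context {R : comPzRingType} {M : lmodType R}.

Definition wedge (s : seq M) : ext M := \prod_(x <- s) ext_in x.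

(* w belongs to the p-th exterior power, the R-span of the p-fold products *)
Definition ext_homog (p : nat) (w : ext M) : Prop :=
  exists s : seq (R * p.-tuple M), w = \sum_(ax <- s) ax.1 *: wedge ax.2.

Lemma wedge_cat s1 s2 : wedge (s1 ++ s2) = wedge s1 * wedge s2.
Proof. by rewrite /wedge big_cat. Qed.

Lemma ext_span (w : ext M) :
  exists s : seq (R * seq M), w = \sum_(ax <- s) ax.1 *: wedge ax.2.
Proof.
elim/(@ext_ind R M): w; elim.
- move=> a; exists [:: (a, [::])].
  by rewrite big_seq1 /wedge big_nil -ext_scalE.
- by move=> x; exists [:: (1, [:: x])]; rewrite big_seq1 /wedge big_seq1 scale1r.
- move=> t [s1 e1] u [s2 e2]; exists (s1 ++ s2).
  by rewrite big_cat /= -e1 -e2 ext_piD.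
- move=> t [s1 e1] u [s2 e2].
  exists [seq (x.1 * y.1, x.2 ++ y.2) | x <- s1, y <- s2].
  rewrite big_allpairs_dep /= ext_piM e1 e2 big_distrl; apply: eq_bigr => x _.
  rewrite big_distrr; apply: eq_bigr => y _ /=.
  by rewrite wedge_cat -ext_scaleAl -ext_scaleAr scalerA.
Qed.

End ExtGrading.

(** * Derivations and Lie--Rinehart algebras

   A commutative [k]-algebra is a commutative ring [A] with its structure
   morphism [eta : k -> A]; [k] acts on [A]-modules through [eta]. *)

Section Derivations.
Context {k : fieldType} {A : comPzRingType} (eta : {rmorphism k -> A}).

Definition is_derivation (D : A -> A^o) : Prop :=
  [/\ forall a b, D (a + b) = D a + D b,
      forall c a, D (eta c * a) = eta c * D a
    & forall a b, D (a * b) = D a * b + a * D b].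

Definition derivation_pred : {pred A -> A^o} := fun D => `[< is_derivation D >].

Fact derivation_submod_closed : submod_closed derivation_pred.
Proof.
split=> [|a D E /asboolP[D1 D2 D3] /asboolP[E1 E2 E3]]; apply/asboolP; split.
- by move=> a b; rewrite /GRing.zero /= addr0.
- by move=> a b; rewrite /GRing.zero /= mulr0.
- by move=> a b; rewrite /GRing.zero /= mulr0 mul0r addr0.
- move=> b c; rewrite !fctE D1 E1 /GRing.scale /= mulrDr.
  by rewrite addrACA.
- by move=> c b; rewrite !fctE D2 E2 /GRing.scale /= mulrDr mulrCA.
- move=> b c; rewrite !fctE D3 E3 /GRing.scale /=.
  by rewrite !mulrDr !mulrDl addrACA !mulrA (mulrC b a).
Qed.

HB.instance Definition _ :=
  GRing.isSubmodClosed.Build A (A -> A^o) derivation_pred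
    derivation_submod_closed.

(* Der_k(A) *)
Record der : Type := Der { der_fun : A -> A^o; _ : der_fun \in derivation_pred }.

HB.instance Definition _ := [isSub for der_fun].
HB.instance Definition _ := [Choice of der by <:].
HB.instance Definition _ := [SubChoice_isSubLmodule of der by <:].

Definition der_app (D : der) : A -> A := der_fun D.
Coercion der_app : der >-> Funclass.

Lemma derP (D E : der) : (forall a, D a = E a) -> D = E.
Proof. by move=> DE; apply/val_inj/funext => a; apply: DE. Qed.

Lemma der_prop (D : der) : is_derivation D.
Proof. by case: D => D HD; exact/asboolP. Qed.

Lemma der_addE (D E : der) a : (D + E) a = D a + E a.
Proof. by []. Qed.

Lemma der_0E a : (0 : der) a = 0.
Proof. by []. Qed.

Lemma der_scaleE b (D : der) a : (b *: D) a = b * D a.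
Proof. by []. Qed.

Lemma derD (D : der) a b : D (a + b) = D a + D b.
Proof. by case: (der_prop D). Qed.

Lemma derZ (D : der) c a : D (eta c * a) = eta c * D a.
Proof. by case: (der_prop D). Qed.

Lemma derM (D : der) a b : D (a * b) = D a * b + a * D b.
Proof. by case: (der_prop D). Qed.

Lemma derN (D : der) a : D (- a) = - D a.
Proof.
apply/eqP; rewrite -subr_eq0 opprK -derD addNr.
by apply/eqP/(addrI (D 0)); rewrite -derD !addr0.
Qed.

Lemma derB (D : der) a b : D (a - b) = D a - D b.
Proof. by rewrite derD derN. Qed.

Lemma der_eta (D : der) c : D (eta c) = 0.
Proof.
have D1 : D 1 = 0.
  apply: (addrI (D 1)); rewrite addr0.
  by have := derM D 1 1; rewrite !mulr1 mul1r => /esym.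
by rewrite -[eta c]mulr1 derZ D1 mulr0.
Qed.

Record lieRinehart (L : lmodType A) : Type := LieRinehart {
  lie : L -> L -> L;
  anchor : {linear L -> der};
  lieDl : forall X Y Z, lie (X + Y) Z = lie X Z + lie Y Z;
  lieDr : forall X Y Z, lie X (Y + Z) = lie X Y + lie X Z;
  lieZl : forall c X Y, lie (eta c *: X) Y = eta c *: lie X Y;
  lieZr : forall c X Y, lie X (eta c *: Y) = eta c *: lie X Y;
  lie_alt : forall X, lie X X = 0;
  lie_jacobi : forall X Y Z,
    lie X (lie Y Z) + lie Y (lie Z X) + lie Z (lie X Y) = 0;
  anchor_lie : forall X Y a,
    anchor (lie X Y) a = anchor X (anchor Y a) - anchor Y (anchor X a);
  lie_leibniz : forall X f Y,
    lie X (f *: Y) = f *: lie X Y + anchor X f *: Y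
}.

Fact der_comm_subproof (D E : der) :
  (fun a => D (E a) - E (D a)) \in derivation_pred.
Proof.
apply/asboolP; split=> [a b|c a|a b].
- by rewrite !derD opprD addrACA.
- by rewrite !derZ mulrBr.
- by rewrite !derM !derD !derM; ring.
Qed.

Definition der_comm (D E : der) : der := Der (der_comm_subproof D E).

Lemma der_commE D E a : der_comm D E a = D (E a) - E (D a).
Proof. by []. Qed.

(* (A, Der_k(A)), with the commutator bracket and the identity as anchor *)
Definition der_lieRinehart : lieRinehart der.
Proof.
refine (@LieRinehart der der_comm idfun _ _ _ _ _ _ _ _).
all: move=> *; try by [].
all: apply: derP => a; rewrite !(der_addE, der_commE, der_scaleE, der_0E) /=.
all: rewrite ?der_addE ?der_commE ?der_scaleE.
all: rewrite ?(derD, derN, derM, der_eta) ?der_scaleE; ring.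
Defined.

Lemma der_anchorE (D : der) a : anchor der_lieRinehart D a = D a.
Proof. by []. Qed.

End Derivations.

(** * Schouten bracket, divergence operators and BV operators *)

Section Gerstenhaber.
Context {k : fieldType} {A : comPzRingType} {eta : {rmorphism k -> A}}.
Context {L : lmodType A} (LR : lieRinehart eta L).

(* The signs (-1)^((p-1)q) and (-1)^((p-1)(q-1)) are written with [p.+1] and
   [q.+1], of the same parity as p-1 and q-1, because [p] and [q] may be 0. *)
Record is_schouten (br : ext L -> ext L -> ext L) : Prop := IsSchouten {
  sbDl : forall u v w : ext L, br (u + v) w = br u w + br v w;
  sbDr : forall u v w : ext L, br u (v + w) = br u v + br u w;
  sbZl : forall c (u v : ext L), br (eta c *: u) v = eta c *: br u v;
  sbZr : forall c (u v : ext L), br u (eta c *: v) = eta c *: br u v;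
  sb_deg : forall p q r (u v : ext L), (p + q = r.+1)%N ->
    ext_homog p u -> ext_homog q v -> ext_homog r (br u v);
  sb_anti : forall p q (u v : ext L), ext_homog p u -> ext_homog q v ->
    br u v = - ((-1) ^+ (p.+1 * q.+1) * br v u);
  sb_jacobi : forall p q (u v w : ext L),
    ext_homog p u -> ext_homog q v ->
    br u (br v w) = br (br u v) w + (-1) ^+ (p.+1 * q.+1) * br v (br u w);
  sb_leibniz : forall p q (u v w : ext L),
    ext_homog p u -> ext_homog q v ->
    br u (v * w) = br u v * w + (-1) ^+ (p.+1 * q) * (v * br u w);
  sb_lie : forall X Y, br (ext_in X) (ext_in Y) = ext_in (lie LR X Y);
  sb_anchor : forall X f, br (ext_in X) (ext_scal f) = ext_scal (anchor LR X f);
  sb_scal : forall f g, br (ext_scal f) (ext_scal g) = 0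
}.

Record divergence : Type := Divergence {
  div_fun :> L -> A;
  divD : forall X Y, div_fun (X + Y) = div_fun X + div_fun Y;
  div_lie : forall X Y,
    div_fun (lie LR X Y) = anchor LR X (div_fun Y) - anchor LR Y (div_fun X);
  divZ : forall a X, div_fun (a *: X) = a * div_fun X + anchor LR X a
}.

(* The indices i, j of X_1, ..., X_n start from 0 here, hence the successors
   in the signs. *)
Record is_bv (div : divergence) (Delta : ext L -> ext L) : Prop := IsBV {
  bvD : forall u v : ext L, Delta (u + v) = Delta u + Delta v;
  bv_scal : forall a, Delta (ext_scal a) = 0;
  bv_wedge : forall n (X : 'I_n -> L),
    Delta (\prod_(i < n) ext_in (X i)) =
      \sum_(i < n) \sum_(j < n | (i < j)%N)
        (-1) ^+ (i.+1 + j.+1) *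
        (ext_in (lie LR (X i) (X j)) *
         \prod_(l < n | (l != i) && (l != j)) ext_in (X l))
      + \sum_(i < n)
        (-1) ^+ i.+1 *
        (div (X i) *: \prod_(l < n | l != i) ext_in (X l))
}.

(* Derivations (in the ungraded sense) of the k-algebra of multivectors *)
Definition is_ext_derivation (D : ext L -> ext L) : Prop :=
  [/\ forall u v : ext L, D (u + v) = D u + D v,
      forall c (u : ext L), D (eta c *: u) = eta c *: D u
    & forall u v : ext L, D (u * v) = D u * v + u * D v].

(* The degree-one cohomology class of w for a degree-one differential d, as
   the set of the cocycles that differ from w by a coboundary *)
Definition cohom_class1 (d : ext L -> ext L) (w : ext L) : set (ext L) :=
  [set v | [/\ ext_homog 1 v, d v = 0
             & exists2 u, ext_homog 0 u & v - w = d u]].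

(** The pairing [w(df, dg)].  [pair_mx f g X] is the matrix of the
   multiplication by [X(f) e1 + X(g) e2] on the exterior algebra of A^2, in the
   basis 1, e1, e2, e1 e2 (row-vector convention); extended to [ext L], its
   (0, 3) entry is the coefficient of [e1 e2] in the image of [w].  See
   [pairing_wedge] for the resulting formula. *)

Definition pair_mx (f g : A) (X : L) : 'M[A]_4 :=
  \matrix_(i < 4, j < 4)
    match val i, val j with
    | 0%N, 1%N => anchor LR X f
    | 0%N, 2%N => anchor LR X g
    | 1%N, 3%N => anchor LR X g
    | 2%N, 3%N => - anchor LR X f
    | _, _ => 0
    end.

Definition pairing (w : ext L) (f g : A) : A :=
  (ext_lift (@scalar_mx A 4) (pair_mx f g) w) 0 (inord 3).

Lemma anchorDE X Y a : anchor LR (X + Y) a = anchor LR X a + anchor LR Y a.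
Proof. by rewrite raddfD. Qed.

Lemma anchorZE b X a : anchor LR (b *: X) a = b * anchor LR X a.
Proof. by rewrite linearZ. Qed.

Lemma pair_mxD f g X Y : pair_mx f g (X + Y) = pair_mx f g X + pair_mx f g Y.
Proof.
apply/matrixP => i j; rewrite !mxE.
case: i j => [[|[|[|[|i]]]] ?] [[|[|[|[|j]]]] ?] //=;
  by rewrite ?addr0 ?anchorDE ?opprD.
Qed.

Lemma pair_mxZ f g a X : pair_mx f g (a *: X) = a%:M * pair_mx f g X.
Proof.
rewrite [RHS]mul_scalar_mx; apply/matrixP => i j; rewrite !mxE.
case: i j => [[|[|[|[|i]]]] ?] [[|[|[|[|j]]]] ?] //=;
  by rewrite ?mulr0 ?anchorZE ?mulrN.
Qed.

Lemma pair_mxM f g X Y : pair_mx f g X * pair_mx f g Y =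
  \matrix_(i < 4, j < 4)
    if (val i == 0%N) && (val j == 3%N)
    then anchor LR X f * anchor LR Y g - anchor LR Y f * anchor LR X g else 0.
Proof.
apply/matrixP => i j; rewrite !mxE !big_ord_recl big_ord0 !mxE.
case: i j => [[|[|[|[|i]]]] ?] [[|[|[|[|j]]]] ?] //=;
  rewrite ?(mulr0, mul0r, addr0, add0r) //.
by rewrite mulrN [anchor LR X g * _]mulrC.
Qed.

Lemma pair_mx_alt f g X : pair_mx f g X * pair_mx f g X = 0.
Proof.
rewrite pair_mxM subrr; apply/matrixP => i j.
by rewrite !mxE; case: ifP.
Qed.

Lemma pair_mx3 f g X Y Z :
  pair_mx f g X * pair_mx f g Y * pair_mx f g Z = 0.
Proof.
rewrite pair_mxM; apply/matrixP => i j; rewrite !mxE big1 // => l _.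
rewrite !mxE; case: ifP => [/andP[_ /eqP ->]|_]; last by rewrite mul0r.
by rewrite mulr0.
Qed.

Lemma scalar_mx_central (a : A) (B : 'M[A]_4) : B * a%:M = a%:M * B.
Proof. exact: scalar_mxC. Qed.

Let liftD f g := ext_liftD (pair_mxD f g)
  (@scalar_mx_central) (pair_mxZ f g) (pair_mx_alt f g).
Let liftM f g := ext_liftM (pair_mxD f g)
  (@scalar_mx_central) (pair_mxZ f g) (pair_mx_alt f g).
Let liftZ f g := ext_liftZ (pair_mxD f g)
  (@scalar_mx_central) (pair_mxZ f g) (pair_mx_alt f g).
Let lift1 f g := ext_lift1 (pair_mxD f g)
  (@scalar_mx_central) (pair_mxZ f g) (pair_mx_alt f g).
Let lift_in f g := ext_lift_in (pair_mxD f g)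
  (@scalar_mx_central) (pair_mxZ f g) (pair_mx_alt f g).

Lemma pairingD u v f g : pairing (u + v) f g = pairing u f g + pairing v f g.
Proof. by rewrite /pairing liftD mxE. Qed.

Lemma pairingZ a w f g : pairing (a *: w) f g = a * pairing w f g.
Proof. by rewrite /pairing liftZ [_ * _]mul_scalar_mx mxE. Qed.

Definition pairing_seq (s : seq L) (f g : A) : A :=
  if s is [:: X; Y]
  then anchor LR X f * anchor LR Y g - anchor LR Y f * anchor LR X g else 0.

Lemma pairing_wedge s f g : pairing (wedge s) f g = pairing_seq s f g.
Proof.
have lift_wedge t : ext_lift (@scalar_mx A 4) (pair_mx f g) (wedge t) =
    \prod_(X <- t) pair_mx f g X.
  elim: t => [|X t IH]; first by rewrite /wedge !big_nil lift1.
  by rewrite big_cons -IH /wedge big_cons liftM lift_in.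
rewrite /pairing lift_wedge.
case: s => [|X [|Y [|Z s]]] /=.
- by rewrite big_nil !mxE -val_eqE /= inordK.
- by rewrite big_seq1 mxE /= inordK.
- by rewrite big_cons big_seq1 pair_mxM mxE /= inordK.
- by rewrite !big_cons !mulrA pair_mx3 mul0r mxE.
Qed.

Lemma pairing_sum (s : seq (A * seq L)) f g :
  pairing (\sum_(ax <- s) ax.1 *: wedge ax.2) f g =
  \sum_(ax <- s) ax.1 * pairing_seq ax.2 f g.
Proof.
elim: s => [|ax s IH]; last by rewrite !big_cons pairingD pairingZ IH pairing_wedge.
by rewrite !big_nil -[0 in LHS](scale0r (1 : ext L)) pairingZ mul0r.
Qed.

Lemma pairing_anti w f g : pairing w f g = - pairing w g f.
Proof.
have [s ->] := ext_span w; rewrite !pairing_sum -sumrN.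
apply: eq_bigr => -[a [|X [|Y [|Z t]]]] _ /=; rewrite ?mulr0 ?oppr0 //.
by ring.
Qed.

(* the hamiltonian derivation g |-> w(df, dg), written {f, -} *)
Fact hamiltonian_subproof w f :
  (pairing w f : A -> A^o) \in derivation_pred eta.
Proof.
apply/asboolP; have [s ->] := ext_span w; split=> [a b|c a|a b].
- rewrite !pairing_sum -big_split; apply: eq_bigr.
  move=> -[e [|X [|Y [|Z t]]]] _ /=; rewrite ?mulr0 ?addr0 // !derD.
  by ring.
- rewrite !pairing_sum big_distrr; apply: eq_bigr.
  move=> -[e [|X [|Y [|Z t]]]] _ /=; rewrite ?mulr0 // !derZ.
  by ring.
- rewrite !pairing_sum big_distrl big_distrr -big_split; apply: eq_bigr.
  move=> -[e [|X [|Y [|Z t]]]] _ /=; rewrite ?mulr0 ?mul0r ?addr0 // !derM.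
  by ring.
Qed.

Definition hamiltonian w f : der eta := Der (hamiltonian_subproof w f).

Lemma hamiltonianE w f g : hamiltonian w f g = pairing w f g.
Proof. by []. Qed.

End Gerstenhaber.

Arguments is_ext_derivation {k A} eta {L} D.

Section ModularField.
Context {k : fieldType} {A : comPzRingType} {eta : {rmorphism k -> A}}.
Notation LR := (der_lieRinehart eta).
Variable div : divergence LR.

(* the modular vector field f |-> div {f, -} *)
Fact modular_field_subproof (w : ext (der eta)) :
  (fun f => div (hamiltonian LR w f) : A^o) \in derivation_pred eta.
Proof.
apply/asboolP; split=> [f g|c f|f g].
- transitivity (div (hamiltonian LR w f + hamiltonian LR w g)).
    2: exact (divD div (hamiltonian LR w f) (hamiltonian LR w g)).
  congr (div _); apply: derP => h.
  rewrite der_addE !hamiltonianE !(pairing_anti _ _ _ h).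
  by rewrite -!hamiltonianE derD opprD.
- have -> : hamiltonian LR w (eta c * f) = eta c *: hamiltonian LR w f.
    apply: derP => h; rewrite der_scaleE !hamiltonianE !(pairing_anti _ _ _ h).
    by rewrite -!hamiltonianE derZ mulrN.
  by rewrite divZ der_anchorE der_eta addr0.
- have -> : hamiltonian LR w (f * g) =
      f *: hamiltonian LR w g + g *: hamiltonian LR w f.
    apply: derP => h; rewrite der_addE !der_scaleE !hamiltonianE.
    rewrite !(pairing_anti _ _ _ h) -!hamiltonianE derM.
    by ring.
  rewrite divD !divZ !der_anchorE !hamiltonianE (pairing_anti _ _ f g).
  by ring.
Qed.

Definition modular_field w : der eta := Der (modular_field_subproof w).

Lemma modular_fieldE w f : modular_field w f = div (hamiltonian LR w f).
Proof. by []. Qed.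

Definition modular_class (br : ext (der eta) -> ext (der eta) -> ext (der eta))
    (w : ext (der eta)) : set (ext (der eta)) :=
  cohom_class1 (br w) (ext_in (modular_field w)).

End ModularField.

(** * Smooth manifolds *)

Section SmoothFunctions.
Context {R : realType} {n : nat}.
Implicit Types (U : set 'rV[R]_n) (f g : 'rV[R]_n -> R).

(* The iterated partial derivatives of f of order at most m exist on U, and
   those of order m are continuous there. *)
Fixpoint Cm_on U (m : nat) f : Prop :=
  match m with
  | 0 => forall x, U x -> {for x, continuous f}
  | m'.+1 => forall i : 'I_n,
      (forall x, U x -> derivable f x (delta_mx 0 i)) /\
      Cm_on U m' (fun x => 'D_(delta_mx 0 i) f x)
  end.

Definition smooth_on U f : Prop := forall m, Cm_on U m f.

Lemma Cm_on_eq U m f g : open U -> (forall x, U x -> f x = g x) ->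
  Cm_on U m f -> Cm_on U m g.
Proof.
move=> oU; have nfg f' g' x : (forall x, U x -> f' x = g' x :> R) -> U x ->
    \near x, f' x = g' x.
  move=> fg Ux; exact: (filterS fg (open_nbhs_nbhs (conj oU Ux))).
elim: m f g => [|m IH] f g fg /= Cf.
  move=> x Ux; rewrite /prop_for /continuous_at -fg //.
  apply: cvg_trans (Cf x Ux); exact: (near_eq_cvg (nfg f g x fg Ux)).
move=> i; have [df Df] := Cf i; split=> [x Ux|].
  exact: near_eq_derivable (nfg _ _ _ fg Ux) (df x Ux).
by apply: IH Df => x Ux; apply: near_eq_derive; apply: nfg.
Qed.

Lemma smooth_on_derivable U f i x :
  smooth_on U f -> U x -> derivable f x (delta_mx 0 i).
Proof. by move=> sf Ux; have [/(_ x Ux)] := sf 1%N i. Qed.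

Lemma smooth_on_partial U f i :
  smooth_on U f -> smooth_on U (fun x => 'D_(delta_mx 0 i) f x).
Proof. by move=> sf m; have [] := sf m.+1 i. Qed.

Lemma smooth_on_cst U (c : R) : smooth_on U (cst c).
Proof.
move=> m; elim: m c => [|m IH] c /=; first by move=> x _; exact: cst_continuous.
move=> i; split=> [x _|]; first exact: derivable_cst.
rewrite (_ : (fun x => _) = cst 0); first exact: IH.
by apply/funext => x; rewrite derive_cst.
Qed.

Lemma Cm_onD U m f g : open U -> Cm_on U m f -> Cm_on U m g ->
  Cm_on U m (f + g).
Proof.
move=> oU; elim: m f g => [|m IH] f g Cf Cg /=.
  by move=> x Ux; exact: (cvgD (Cf x Ux) (Cg x Ux)).
move=> i; have [df Df] := Cf i; have [dg Dg] := Cg i; split.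
  by move=> x Ux; apply: derivableD; [apply: df|apply: dg].
apply: Cm_on_eq (IH _ _ Df Dg) => // x Ux.
by rewrite deriveD //; [apply: df|apply: dg].
Qed.

Lemma smooth_onD U f g : open U -> smooth_on U f -> smooth_on U g ->
  smooth_on U (f + g).
Proof. by move=> oU sf sg m; apply: Cm_onD. Qed.

Lemma smooth_onM U f g : open U -> smooth_on U f -> smooth_on U g ->
  smooth_on U (f * g).
Proof.
move=> oU + + m; elim: m f g => [|m IH] f g sf sg /=.
  by move=> x Ux; exact: (cvgM (sf 0%N x Ux) (sg 0%N x Ux)).
move=> i; split=> [x Ux|].
  by apply: derivableM; apply: smooth_on_derivable Ux.
apply: (@Cm_on_eq U m (f * (fun x => 'D_(delta_mx 0 i) g x) +
                       g * (fun x => 'D_(delta_mx 0 i) f x))) => //.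
  by move=> x Ux; rewrite deriveM //; apply: smooth_on_derivable Ux.
by apply: Cm_onD => //; apply: IH => //; apply: smooth_on_partial.
Qed.

Lemma smooth_onN U f : open U -> smooth_on U f -> smooth_on U (- f).
Proof.
move=> oU sf; rewrite (_ : - f = cst (-1) * f).
  by apply: smooth_onM => //; apply: smooth_on_cst.
by apply/funext => x; rewrite !fctE mulN1r.
Qed.

End SmoothFunctions.

(* A homeomorphism [chart_map] between open subsets [chart_dom] of M and
   [chart_cod] of R^n, with inverse [chart_inv]; the values of these two
   functions outside [chart_dom] and [chart_cod] are irrelevant. *)
Record chart (R : realType) (n : nat) (M : topologicalType) : Type := Chart {
  chart_dom : set M;
  chart_cod : set 'rV[R]_n;
  chart_map : M -> 'rV[R]_n;
  chart_inv : 'rV[R]_n -> M;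
  chart_dom_open : open chart_dom;
  chart_cod_open : open chart_cod;
  chart_map_cod : forall x, chart_dom x -> chart_cod (chart_map x);
  chart_inv_dom : forall y, chart_cod y -> chart_dom (chart_inv y);
  chart_mapK : forall x, chart_dom x -> chart_inv (chart_map x) = x;
  chart_invK : forall y, chart_cod y -> chart_map (chart_inv y) = y;
  chart_map_cont : forall x, chart_dom x -> {for x, continuous chart_map};
  chart_inv_cont : forall y, chart_cod y -> {for y, continuous chart_inv}
}.

Record smoothManifold (R : realType) (n : nat) : Type := SmoothManifold {
  mfd_space :> topologicalType;
  mfd_hausdorff : hausdorff_space mfd_space;
  mfd_second_countable : @second_countable mfd_space;
  mfd_atlas : set (chart R n mfd_space);
  mfd_cover : forall x : mfd_space, exists2 c, mfd_atlas c & chart_dom c x;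
  mfd_compat : forall c c', mfd_atlas c -> mfd_atlas c' ->
    forall i : 'I_n,
      smooth_on (chart_cod c `&` chart_inv c @^-1` chart_dom c')
        (fun y => chart_map c' (chart_inv c y) 0 i)
}.

Section SmoothAlgebra.
Context {R : realType} {n : nat} (M : smoothManifold R n).

Definition smooth_fun_pred : {pred M -> R} := fun f =>
  `[< forall c, mfd_atlas c -> smooth_on (chart_cod c) (f \o chart_inv c) >].

Fact smooth_fun_subring_closed : subring_closed smooth_fun_pred.
Proof.
split=> [|f g /asboolP sf /asboolP sg|f g /asboolP sf /asboolP sg].
- by apply/asboolP => c _; apply: (smooth_on_cst (chart_cod c) 1).
- apply/asboolP => c Mc; have oc := @chart_cod_open _ _ _ c.
  rewrite (_ : _ \o _ = (f \o chart_inv c) + - (g \o chart_inv c)) //.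
  exact: smooth_onD oc (sf c Mc) (smooth_onN oc (sg c Mc)).
- apply/asboolP => c Mc; have oc := @chart_cod_open _ _ _ c.
  rewrite (_ : _ \o _ = (f \o chart_inv c) * (g \o chart_inv c)) //.
  exact: smooth_onM oc (sf c Mc) (sg c Mc).
Qed.

HB.instance Definition _ :=
  GRing.isSubringClosed.Build (M -> R) smooth_fun_pred
    smooth_fun_subring_closed.

(* The ring C^oo(M) *)
Record Cinfty : Type :=
  MkCinfty { Cinfty_fun :> M -> R; _ : Cinfty_fun \in smooth_fun_pred }.

HB.instance Definition _ := [isSub for Cinfty_fun].
HB.instance Definition _ := [Choice of Cinfty by <:].
HB.instance Definition _ :=
  GRing.SubChoice_isSubComPzRing.Build (M -> R) smooth_fun_pred Cinfty
    smooth_fun_subring_closed.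

Fact Cinfty_cst_subproof (r : R) : (cst r : M -> R) \in smooth_fun_pred.
Proof. by apply/asboolP => c _; apply: (smooth_on_cst (chart_cod c) r). Qed.

Definition Cinfty_cst (r : R) : Cinfty := MkCinfty (Cinfty_cst_subproof r).

Fact Cinfty_cst_zmod : zmod_morphism Cinfty_cst.
Proof. by move=> r s; apply/val_inj/funext. Qed.

Fact Cinfty_cst_monoid : monoid_morphism Cinfty_cst.
Proof. by split=> [|r s]; apply/val_inj/funext. Qed.

HB.instance Definition _ :=
  GRing.isZmodMorphism.Build R Cinfty Cinfty_cst Cinfty_cst_zmod.
HB.instance Definition _ :=
  GRing.isMonoidMorphism.Build R Cinfty Cinfty_cst Cinfty_cst_monoid.

End SmoothAlgebra.

(* Main.v *)
(** Write [X] also for left multiplication by a vector, [L_X = [X, -]] and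
   [D_f = [f, -]].  The explicit formula for [Delta] amounts to the operator
   recursion [Delta X = - div X - X Delta - L_X].  Inducting on multivectors
   through it yields [Delta f - f Delta = D_f],
   [Delta L_X - L_X Delta = - D_(div X)] and then [Delta^2 = 0].  For a
   bivector [w] it also yields [[w, b] = Delta (w b) - Delta w b - w Delta b];
   substituting this twice, [Delta [w, b] + [w, Delta b]] becomes
   [- Delta (Delta w b) - Delta w Delta b], which is [[Delta w, b]] since
   [div (Delta w) = - Delta^2 w = 0].  For [b = w] with [[w, w] = 0] this gives
   [2 [w, Delta w] = 0] by antisymmetry. *)
Require Import Defs.
From HB Require Import structures.
From mathcomp Require Import all_boot all_order all_algebra.
From mathcomp Require Import ring.
From mathcomp Require Import boolp classical_sets functions.
From mathcomp Require Import reals topology normedtype derive.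

Set Implicit Arguments.
Unset Strict Implicit.
Unset Printing Implicit Defensive.

Import GRing.Theory Num.Theory.
Local Open Scope ring_scope.

(** * Induction and index splitting in the exterior algebra *)

Section ExteriorInduction.
Context {A : comPzRingType} {L : lmodType A}.
Implicit Types (X Y : L) (b u v w : ext L).

Lemma ext_scale_scal (f : A) b : ext_scal f * b = f *: b.
Proof. by []. Qed.

Lemma ext_scaleM (f : A) u v : u * (f *: v) = f *: (u * v).
Proof. by rewrite ext_scaleAr. Qed.

Lemma ext_in_anticomm X Y : ext_in X * ext_in Y = - (ext_in Y * ext_in X).
Proof.
apply/eqP; rewrite -addr_eq0; apply/eqP.
have := ext_alt (X + Y).
by rewrite ext_inD mulrDl !mulrDr !ext_alt add0r addr0.
Qed.

Lemma scale_wedge_cons (a : A) X s : a *: wedge (X :: s) = wedge ((a *: X) :: s).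
Proof. by rewrite /wedge !big_cons ext_inZ ext_scaleAl. Qed.

Lemma wedge_nth (s : seq L) : wedge s = \prod_(i < size s) ext_in s`_i.
Proof. by rewrite /wedge (big_nth 0) big_mkord. Qed.

(** Coefficients need no case of their own: in a nonempty product they are absorbed into the first
    factor, and the empty product with a coefficient is a scalar. *)
Lemma ext_wedge_ind (P : ext L -> Prop) :
  (forall u v, P u -> P v -> P (u + v)) -> (forall a, P (ext_scal a)) ->
  (forall X s, P (wedge (X :: s))) -> forall w, P w.
Proof.
move=> PD Ps Pw w; have [s ->] := ext_span w.
elim: s => [|[a [|X t]] s IH]; rewrite ?big_nil ?big_cons /=.
- by have := Ps 0; rewrite ext_scalE scale0r.
- by apply: PD IH; rewrite /wedge big_nil -ext_scalE.
- by apply: PD IH; rewrite scale_wedge_cons.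
Qed.

Lemma ext_mul_ind (P : ext L -> Prop) :
  (forall u v, P u -> P v -> P (u + v)) -> (forall a, P (ext_scal a)) ->
  (forall X b, P b -> P (ext_in X * b)) -> forall w, P w.
Proof.
move=> PD Ps PM; apply: ext_wedge_ind => // X s.
elim: s X => [|Y s IH] X; rewrite /wedge big_cons; apply: PM; last exact: IH.
by rewrite big_nil; have := Ps 1; rewrite ext_scalE scale1r.
Qed.

(** This splitting and its variants below peel the first factor off the products with omitted
    indices in [bv_wedge]. *)
Lemma prod_ord_recl n (Q : pred 'I_n.+1) (F : 'I_n.+1 -> ext L) :
  \prod_(l < n.+1 | Q l) F l =
  (if Q ord0 then F ord0 else 1) *
  \prod_(l < n | Q (lift ord0 l)) F (lift ord0 l).
Proof. by rewrite big_mkcond big_ord_recl -big_mkcond. Qed.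

Lemma prod_lift0 n (F : 'I_n.+1 -> ext L) :
  \prod_(l < n.+1 | l != ord0) F l = \prod_(l < n) F (lift ord0 l).
Proof. by rewrite prod_ord_recl mul1r. Qed.

Lemma prod_lift1 n (F : 'I_n.+1 -> ext L) (j : 'I_n) :
  \prod_(l < n.+1 | l != lift ord0 j) F l =
  F ord0 * \prod_(l < n | l != j) F (lift ord0 l).
Proof.
by rewrite prod_ord_recl.
Qed.

Lemma prod_lift01 n (F : 'I_n.+1 -> ext L) (j : 'I_n) :
  \prod_(l < n.+1 | (l != ord0) && (l != lift ord0 j)) F l =
  \prod_(l < n | l != j) F (lift ord0 l).
Proof.
by rewrite prod_ord_recl mul1r.
Qed.

Lemma prod_lift2 n (F : 'I_n.+1 -> ext L) (i j : 'I_n) :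
  \prod_(l < n.+1 | (l != lift ord0 i) && (l != lift ord0 j)) F l =
  F ord0 * \prod_(l < n | (l != i) && (l != j)) F (lift ord0 l).
Proof.
by rewrite prod_ord_recl.
Qed.

Lemma sum_ord_recl n (Q : pred 'I_n.+1) (F : 'I_n.+1 -> ext L) :
  \sum_(l < n.+1 | Q l) F l =
  (if Q ord0 then F ord0 else 0) +
  \sum_(l < n | Q (lift ord0 l)) F (lift ord0 l).
Proof. by rewrite big_mkcond big_ord_recl -big_mkcond. Qed.

Lemma sign_mulCA n u v : u * ((-1) ^+ n * v) = (-1) ^+ n * (u * v).
Proof. by rewrite !mulrA commr_sign. Qed.

Lemma ext_homog_scal (a : A) : ext_homog 0 (ext_scal a : ext L).
Proof.
exists [:: (a, [tuple])].
by rewrite big_seq1 /= /wedge big_nil -ext_scalE.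
Qed.

Lemma ext_homog_in X : ext_homog 1 (ext_in X).
Proof.
exists [:: (1, [tuple X])].
by rewrite big_seq1 /= /wedge big_seq1 scale1r.
Qed.

Lemma ext_homog_in2 X Y : ext_homog 2 (ext_in X * ext_in Y).
Proof.
exists [:: (1, [tuple X; Y])].
by rewrite big_seq1 /= /wedge big_cons big_seq1 scale1r.
Qed.

Lemma ext_homog2_ind (P : ext L -> Prop) :
  P 0 -> (forall u v, P u -> P v -> P (u + v)) ->
  (forall X Y, P (ext_in X * ext_in Y)) -> forall w, ext_homog 2 w -> P w.
Proof.
move=> P0 PD PM w [s ->]; elim: s => [|[a t] s IH]; rewrite ?big_nil // big_cons.
apply: PD IH; case: t => [[|X [|Y [|Z t]]] // i] /=.
by rewrite scale_wedge_cons /wedge big_cons big_seq1.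
Qed.

End ExteriorInduction.

(** * Brackets with functions and vectors *)

Section BVOperator.
Context {k : fieldType} {A : comPzRingType} {eta : {rmorphism k -> A}}.
Context {L : lmodType A} {LR : lieRinehart eta L} {div : divergence LR}.
Context {br : ext L -> ext L -> ext L} {Delta : ext L -> ext L}.
Context (schouten : is_schouten LR br) (bv : is_bv div Delta).
Implicit Types (X Y Z : L) (b c u v w : ext L) (f g : A).


Lemma bv0 : Delta 0 = 0.
Proof. by apply: (addrI (Delta 0)); rewrite -(bvD bv) !addr0. Qed.

Lemma bvN u : Delta (- u) = - Delta u.
Proof. by apply: (addrI (Delta u)); rewrite -(bvD bv) !subrr bv0. Qed.

Lemma bv1 : Delta 1 = 0.
Proof. by rewrite -[1]scale1r -ext_scalE (bv_scal bv). Qed.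

Lemma sb0l w : br 0 w = 0.
Proof. by apply: (addrI (br 0 w)); rewrite -(sbDl schouten) !addr0. Qed.

Lemma sb0r u : br u 0 = 0.
Proof. by apply: (addrI (br u 0)); rewrite -(sbDr schouten) !addr0. Qed.

Lemma sbNr u w : br u (- w) = - br u w.
Proof. by apply: (addrI (br u w)); rewrite -(sbDr schouten) !subrr sb0r. Qed.

Lemma sb_scalr X f b : br (ext_in X) (f *: b) =
  anchor LR X f *: b + f *: br (ext_in X) b.
Proof.
rewrite -ext_scale_scal.
rewrite (sb_leibniz schouten _ (ext_homog_in X) (ext_homog_scal f)).
by rewrite (sb_anchor schouten) muln0 mul1r.
Qed.

Lemma sb_vec_mul X Y b : br (ext_in X) (ext_in Y * b) =
  ext_in (lie LR X Y) * b + ext_in Y * br (ext_in X) b.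
Proof.
rewrite (sb_leibniz schouten _ (ext_homog_in X) (ext_homog_in Y)).
by rewrite (sb_lie schouten) sqrrN expr1n mul1r.
Qed.

Lemma sb_vec_derivation X u v :
  br (ext_in X) (u * v) = br (ext_in X) u * v + u * br (ext_in X) v.
Proof.
elim/(@ext_mul_ind A L): u => [u1 u2 IH1 IH2|f|Y b IH].
- by rewrite mulrDl !(sbDr schouten) IH1 IH2 !mulrDl addrACA.
- by rewrite (sb_anchor schouten) !ext_scale_scal sb_scalr.
- by rewrite -mulrA !sb_vec_mul IH mulrDl mulrDr !mulrA addrA.
Qed.

Lemma sb_lie_vec X Y b : br (ext_in (lie LR X Y)) b =
  br (ext_in X) (br (ext_in Y) b) - br (ext_in Y) (br (ext_in X) b).
Proof.
rewrite (sb_jacobi schouten _ (ext_homog_in X) (ext_homog_in Y)).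
by rewrite (sb_lie schouten) -signr_odd mul1r addrK.
Qed.

Lemma sb_fun_vec f X : br (ext_scal f) (ext_in X) = - ext_scal (anchor LR X f).
Proof.
rewrite (sb_anti schouten (ext_homog_scal f) (ext_homog_in X)).
by rewrite (sb_anchor schouten) -signr_odd mul1r.
Qed.

Lemma sb_fun_mul f X b : br (ext_scal f) (ext_in X * b) =
  - (anchor LR X f *: b) - ext_in X * br (ext_scal f) b.
Proof.
rewrite (sb_leibniz schouten _ (ext_homog_scal f) (ext_homog_in X)).
by rewrite sb_fun_vec mulNr ext_scale_scal mulN1r.
Qed.

Lemma lie_anti X Y : lie LR X Y = - lie LR Y X.
Proof.
apply/eqP; rewrite -addr_eq0; apply/eqP.
have := lie_alt LR (X + Y).
by rewrite lieDl !lieDr !lie_alt add0r addr0.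
Qed.

(** A Leibniz rule in the first slot. Since [sb_leibniz] concerns the second slot, it is obtained by
    induction on [b]; the term in Y(f) from [fX, Y] matches the one from [f, Y b] once X and Y are
    swapped. *)
Lemma sb_scale_vec f X b : br (ext_in (f *: X)) b =
  f *: br (ext_in X) b + ext_in X * br (ext_scal f) b.
Proof.
elim/(@ext_mul_ind A L): b => [b c IHb IHc|g|Y b IH].
- by rewrite !(sbDr schouten) IHb IHc scalerDr mulrDr addrACA.
- rewrite !(sb_anchor schouten) (sb_scal schouten) mulr0 addr0.
  by rewrite anchorZE ext_scalM.
have lieE : lie LR (f *: X) Y = f *: lie LR X Y - anchor LR Y f *: X.
  by rewrite lie_anti lie_leibniz opprD -scalerN -lie_anti.
rewrite !sb_vec_mul sb_fun_mul IH lieE. rewrite linearB /= !ext_inZ !mulrDl.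
rewrite mulNr -!ext_scaleAl !mulrDr !mulrN !ext_scaleM scalerDr -!addrA; congr (_ + _).
rewrite addrCA; congr (_ + (_ + _)).
by rewrite !mulrA ext_in_anticomm mulNr.
Qed.

Lemma sb_vec1 X : br (ext_in X) 1 = 0.
Proof.
apply: (addrI (br (ext_in X) 1)); rewrite addr0.
by have := sb_vec_derivation X 1 1; rewrite !mulr1 mul1r.
Qed.

(** * The recursion for the BV operator and its consequences *)

Lemma sb_vec_prod n X (Y : 'I_n -> L) :
  br (ext_in X) (\prod_(i < n) ext_in (Y i)) =
  \sum_(j < n) (-1) ^+ j *
    (ext_in (lie LR X (Y j)) * \prod_(l < n | l != j) ext_in (Y l)).
Proof.
elim: n Y => [|n IH] Y; first by rewrite !big_ord0 sb_vec1.
rewrite !big_ord_recl sb_vec_mul IH mul1r prod_ord_recl mul1r mulr_sumr.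
congr (_ + _); apply: eq_bigr => j _.
(* Moving the bracket with a later factor to the front, past the first factor, costs the extra
   sign. *)
rewrite prod_lift1 sign_mulCA lift0 exprS mulN1r mulNr -mulrN.
congr (_ * _).
by rewrite !mulrA (ext_in_anticomm (Y ord0)) mulNr.
Qed.

(** In the explicit formula, the terms with i = 0 give the divergence term and, by [sb_vec_prod],
    the bracket with the first factor. The others give the middle term: its sign comes from the
    shifted index in the divergence sum, and from moving the first factor past the bracket in the
    double sum. *)
Lemma bv_ord_recl n (Z : 'I_n.+1 -> L) :
  Delta (\prod_(i < n.+1) ext_in (Z i)) =
  - (div (Z ord0) *: \prod_(i < n) ext_in (Z (lift ord0 i)))
  - ext_in (Z ord0) * Delta (\prod_(i < n) ext_in (Z (lift ord0 i)))
  - br (ext_in (Z ord0)) (\prod_(i < n) ext_in (Z (lift ord0 i))).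
Proof.
rewrite sb_vec_prod !(bv_wedge bv) big_ord_recl.
rewrite [X in _ + _ + X = _]big_ord_recl expr1 mulN1r prod_lift0.
set Q := div (Z ord0) *: _; rewrite sum_ord_recl add0r.
rewrite (AC (2*2) (3*(2*4)*1)); congr (_ + _ + _).
  rewrite mulrDr opprD !mulr_sumr -!sumrN; congr (_ + _).
    apply: eq_bigr => i _; rewrite sum_ord_recl add0r mulr_sumr -sumrN.
    apply: eq_bigr => j _; rewrite prod_lift2 sign_mulCA -mulrN.
    congr (_ * _); first by rewrite !lift0 !addSn !addnS !exprS !mulN1r !opprK.
    by rewrite !mulrA (ext_in_anticomm (Z ord0)) mulNr opprK.
  apply: eq_bigr => i _; rewrite prod_lift1 sign_mulCA -ext_scaleM.
  by rewrite lift0 exprS mulN1r mulNr.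
rewrite -sumrN; apply: eq_bigr => j _; rewrite prod_lift01.
by rewrite !lift0 !exprS !mulN1r !opprK mulNr.
Qed.

Lemma bv_vec_mul X b : Delta (ext_in X * b) =
  - (div X *: b) - ext_in X * Delta b - br (ext_in X) b.
Proof.
elim/(@ext_wedge_ind A L): b => [b c IHb IHc|f|Y s].
- rewrite mulrDr (sbDr schouten) !(bvD bv) IHb IHc scalerDr mulrDr !opprD.
  by rewrite (AC (3*3) (1*4*(2*5)*(3*6))).
- rewrite (bv_scal bv) mulr0 subr0 (sb_anchor schouten) ext_scalC ext_scale_scal -ext_inZ.
  (* The product of X with the scalar f is the one-factor product fX with tail 1, and div(fX) = f
     div X + X(f) supplies both terms. *)
  have := bv_ord_recl (fun _ : 'I_1 => f *: X).
  rewrite big_ord1 big_ord0 => ->; rewrite sb_vec1 bv1 mulr0 !subr0.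
  rewrite divZ -opprD; congr (- _).
  by rewrite !ext_scalE scalerA mulrC scalerDl.
(* Index 0 carries X, and the lifted indices run through [Y :: s]. *)
rewrite wedge_nth; have := @bv_ord_recl (size s).+1 (fun i => nth 0 [:: X, Y & s] i).
by rewrite big_ord_recl.
Qed.

(** On a product Y b, the defect Y(f) of div(fY) and the defect Y [f, b] of [fY, b] together make up
    [f, Y b]. *)
Lemma bv_scale_sb f b : Delta (f *: b) = f *: Delta b + br (ext_scal f) b.
Proof.
elim/(@ext_mul_ind A L): b => [b c IHb IHc|g|Y b IH].
- by rewrite scalerDr (sbDr schouten) !(bvD bv) IHb IHc scalerDr addrACA.
- rewrite -ext_scale_scal -ext_scalM !(bv_scal bv) (sb_scal schouten).
  by rewrite scaler0 addr0.
rewrite ext_scaleAl -ext_inZ !bv_vec_mul sb_scale_vec sb_fun_mul divZ.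
rewrite ext_inZ -ext_scaleAl !scalerBr scalerN scalerA scalerDl !opprD.
by rewrite (AC (3*2) (1*3*4*(2*5))).
Qed.

Lemma bv_sb_vec X b : Delta (br (ext_in X) b) =
  br (ext_in X) (Delta b) - br (ext_scal (div X)) b.
Proof.
elim/(@ext_mul_ind A L): b => [b c IHb IHc|g|Y b IH].
- by rewrite !((sbDr schouten), (bvD bv)) IHb IHc opprD addrACA.
- by rewrite (sb_anchor schouten) !(bv_scal bv) sb0r (sb_scal schouten) subr0.
rewrite sb_vec_mul (bvD bv) !bv_vec_mul !((sbDr schouten), sbNr) sb_vec_mul.
rewrite sb_scalr sb_fun_mul sb_lie_vec div_lie IH scalerBl mulrBr.
rewrite !opprD !opprK.
(* Expanding [[X, Y], b] by Jacobi leaves two opposite copies of [Y, [X, b]], which cancel. *)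
by rewrite (AC (3*2*(1*2*1)) (1*6*(3*7)*4*(2*8)*(5*9))) /= subrr addr0.
Qed.

(** On X b, the correction from commuting [Delta] past div X cancels the one from commuting it past
    [X, -]. *)
Lemma bv_square b : Delta (Delta b) = 0.
Proof.
elim/(@ext_mul_ind A L): b => [b c IHb IHc|g|X b IH].
- by rewrite !(bvD bv) IHb IHc addr0.
- by rewrite (bv_scal bv) bv0.
rewrite bv_vec_mul !((bvD bv), bvN) bv_scale_sb bv_vec_mul bv_sb_vec IH mulr0.
rewrite !opprD !opprK.
by rewrite (AC (2*3*2) ((1*3)*(2*7)*(5*6)*4)) /= !addNr subrr !addr0.
Qed.

(** * Bivectors and the commutator of [Delta] with their brackets *)

Lemma bv_vec X : Delta (ext_in X) = - ext_scal (div X).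
Proof.
have := bv_vec_mul X 1.
by rewrite mulr1 sb_vec1 bv1 mulr0 !subr0 -ext_scalE.
Qed.

Lemma bv_bivec X Y : Delta (ext_in X * ext_in Y) =
  ext_in (div Y *: X - div X *: Y - lie LR X Y).
Proof.
rewrite bv_vec_mul bv_vec (sb_lie schouten) mulrN opprK ext_scalC ext_scale_scal.
by rewrite !linearB /= !ext_inZ [- _ + _]addrC.
Qed.

(** For b = Z c, antisymmetry turns [X Y, Z] into a bracket with a vector, computed by [sb_vec_mul];
    induction handles [X Y, c]. *)
Lemma sb_bivec X Y b : br (ext_in X * ext_in Y) b =
  ext_in X * br (ext_in Y) b - ext_in Y * br (ext_in X) b.
Proof.
have homXY := ext_homog_in2 X Y.
elim/(@ext_mul_ind A L): b => [b c IHb IHc|g|Z b IH].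
- by rewrite !(sbDr schouten) IHb IHc !mulrDr opprD addrACA.
- rewrite (sb_anti schouten homXY (ext_homog_scal g)) sb_fun_mul sb_fun_vec.
  rewrite !(sb_anchor schouten) -signr_odd /= expr1 mulN1r opprK.
  by rewrite mulrN opprK !ext_scalC !ext_scale_scal addrC.
rewrite (sb_leibniz schouten _ homXY (ext_homog_in Z)) -signr_odd /= mulN1r.
rewrite (sb_anti schouten homXY (ext_homog_in Z)) -signr_odd /= mul1r IH.
rewrite !sb_vec_mul !(sb_lie schouten) (lie_anti Z X) (lie_anti Z Y).
rewrite !linearN /= !mulrN !mulNr.
rewrite -mulNr opprD !opprK mulrDl (ext_in_anticomm (lie LR X Z)) mulrBr.
rewrite !mulrDr !mulrA (ext_in_anticomm Z X) (ext_in_anticomm Z Y) !mulNr.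
by rewrite !opprD !opprK (AC (2*2) (2*3*(1*4))).
Qed.

Lemma bv_bivec_mul w b : ext_homog 2 w ->
  Delta (w * b) = Delta w * b + w * Delta b + br w b.
Proof.
move: w; apply: ext_homog2_ind => [|u v IHu IHv|X Y].
- by rewrite bv0 !mul0r bv0 sb0l !addr0.
- rewrite mulrDl !(bvD bv) IHu IHv (sbDl schouten) !mulrDl.
  by rewrite (AC (3*3) (1*4*(2*5)*(3*6))).
rewrite -mulrA !bv_vec_mul bv_vec (sb_lie schouten) sb_vec_mul sb_bivec.
rewrite !mulrN ext_scalC ext_scale_scal !mulrDl !mulNr -!ext_scaleAl !mulrDr.
rewrite !mulrN ext_scaleM !mulrA !opprD !opprK.
by rewrite (AC (1*3*2) (1*2*5*3*(4*6))).
Qed.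

Lemma bv_bivec_exists w : ext_homog 2 w -> exists X, Delta w = ext_in X.
Proof.
move: w; apply: ext_homog2_ind => [|u v [X eX] [Y eY]|X Y].
- by exists 0; rewrite bv0 linear0.
- by exists (X + Y); rewrite (bvD bv) eX eY linearD.
- by exists (div Y *: X - div X *: Y - lie LR X Y); rewrite bv_bivec.
Qed.

Lemma bv_sb_comm w b : ext_homog 2 w ->
  Delta (br w b) + br w (Delta b) = br (Delta w) b.
Proof.
move=> w2; have [X eX] := bv_bivec_exists w2.
have brE c : br w c = Delta (w * c) - Delta w * c - w * Delta c.
  by rewrite (bv_bivec_mul c w2) -addrA -opprD addrC addKr.
(* The vanishing is asserted in [ext L], where [Delta] squares to zero, rather than in [A]. *)
have divX0 : ext_scal (div X) = 0 :> ext L.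
  by apply: oppr_inj; rewrite -bv_vec -eX bv_square oppr0.
rewrite !brE !((bvD bv), bvN) !bv_square sub0r mulr0 subr0 eX bv_vec_mul.
rewrite -ext_scale_scal divX0 mul0r oppr0 sub0r.
rewrite opprD !opprK.
by rewrite (AC (2*1*2) (2*(3*4)*(1*5))) /= addNr subrr !addr0.
Qed.

(** The result is left doubled because [k] may have characteristic two. *)
Lemma sb_bivec_cocycle w : ext_homog 2 w -> br w w = 0 ->
  br w (Delta w) + br w (Delta w) = 0.
Proof.
move=> w2 ww; have := bv_sb_comm w w2; have [X ->] := bv_bivec_exists w2.
rewrite ww bv0 add0r (sb_anti schouten (ext_homog_in X) w2) -signr_odd mul1r.
by move=> {1}->; rewrite addNr.
Qed.

End BVOperator.

(** * Identification of [Delta] of a bivector with the modular vector field *)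

Section ModularField.
Context {k : fieldType} {A : comPzRingType} {eta : {rmorphism k -> A}}.
Local Notation LR := (der_lieRinehart eta).
Context {div : divergence LR}.
Implicit Types (X Y : der eta) (u v w : ext (der eta)).

Lemma hamiltonianD u v f :
  hamiltonian LR (u + v) f = hamiltonian LR u f + hamiltonian LR v f.
Proof. by apply: derP => g; rewrite der_addE !hamiltonianE pairingD. Qed.

Lemma hamiltonian_bivec X Y f :
  hamiltonian LR (ext_in X * ext_in Y) f = X f *: Y - Y f *: X.
Proof.
apply: derP => g; rewrite hamiltonianE -scaleNr der_addE !der_scaleE mulNr.
have -> : ext_in X * ext_in Y = wedge [:: X; Y] by rewrite /wedge big_cons big_seq1.
by rewrite pairing_wedge.
Qed.

Lemma modular_fieldD u v :
  modular_field div (u + v) = modular_field div u + modular_field div v.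
Proof.
by apply: derP => f; rewrite der_addE !modular_fieldE hamiltonianD divD.
Qed.

Lemma modular_field0 : modular_field div 0 = 0.
Proof.
by apply: (addrI (modular_field div 0)); rewrite -modular_fieldD !addr0.
Qed.

(** Taking the divergence of X(f) Y - Y(f) X, the derivatives of the coefficients give Y(X(f)) -
    X(Y(f)), which is the bracket term. The right-hand side is that of [bv_bivec]. *)
Lemma modular_field_bivec X Y : modular_field div (ext_in X * ext_in Y) =
  div Y *: X - div X *: Y - lie LR X Y.
Proof.
(* Opposites become scalar multiples so that [divZ] and [der_scaleE] apply to them. *)
apply: derP => f; rewrite modular_fieldE hamiltonian_bivec -!scaleNr.
rewrite -[- lie LR X Y]scaleN1r.
rewrite divD !divZ !der_addE !der_scaleE !der_anchorE derN der_commE.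
by ring.
Qed.

Lemma bv_modular_field br Delta w :
  is_schouten LR br -> is_bv div Delta -> ext_homog 2 w ->
  Delta w = ext_in (modular_field div w).
Proof.
move=> schouten bv; move: w; apply: ext_homog2_ind => [|u v IHu IHv|X Y].
- by rewrite (bv0 bv) modular_field0 linear0.
- by rewrite (bvD bv) IHu IHv modular_fieldD linearD.
- by rewrite (bv_bivec schouten bv) modular_field_bivec.
Qed.

End ModularField.

Lemma lmod_two_torsion_free (R : realType) (n : nat) (M : smoothManifold R n)
    (V : lmodType (Cinfty M)) (x : V) : x + x = 0 -> x = 0.
Proof.
move=> xx; rewrite -[x]scale1r -(rmorph1 (Cinfty_cst M)).
(* The constant function 1 is split as 1/2 + 1/2. *)
by rewrite [1]splitr rmorphD scalerDl -scalerDr xx scaler0.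
Qed.


Theorem theorem3p3 :
  (forall (k : fieldType) (A : comPzRingType) (eta : {rmorphism k -> A})
      (L : lmodType A) (LR : lieRinehart eta L) (div : divergence LR)
      (br : ext L -> ext L -> ext L) (Delta : ext L -> ext L) (Pi : ext L),
      is_schouten LR br ->
      is_bv div Delta ->
      ext_homog 2 Pi ->
      br Pi Pi = 0 ->
      (exists X : L, Delta Pi = ext_in X) /\
      (forall w : ext L,
         Delta (br Pi w) + br Pi (Delta w) = br (Delta Pi) w))
  /\
  (forall (R : realType) (n : nat) (M : smoothManifold R n)
      (div : divergence (der_lieRinehart (Cinfty_cst M)))
      (br : ext (der (Cinfty_cst M)) -> ext (der (Cinfty_cst M)) ->
            ext (der (Cinfty_cst M)))
      (Delta : ext (der (Cinfty_cst M)) -> ext (der (Cinfty_cst M)))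
      (Pi : ext (der (Cinfty_cst M))),
      is_schouten (der_lieRinehart (Cinfty_cst M)) br ->
      is_bv div Delta ->
      ext_homog 2 Pi ->
      br Pi Pi = 0 ->
      [/\ is_ext_derivation (Cinfty_cst M)
            (fun w => Delta (br Pi w) + br Pi (Delta w)),
          forall w, Delta (br Pi w) + br Pi (Delta w) = br (Delta Pi) w,
          Delta Pi = ext_in (modular_field div Pi),
          br Pi (Delta Pi) = 0
        & cohom_class1 (br Pi) (Delta Pi) = modular_class div br Pi]).
Proof.
split=> [k A eta L LR div br Delta Pi schouten bv Pi2 _|
         R n M div br Delta Pi schouten bv Pi2 PiPi].
  split; first exact: bv_bivec_exists schouten bv Pi Pi2.
  by move=> w; apply: bv_sb_comm schouten bv Pi w Pi2.
have comm w := bv_sb_comm schouten bv w Pi2.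
have DeltaPi := bv_modular_field schouten bv Pi2.
split=> //; last by rewrite /modular_class DeltaPi.
(* The operator is the bracket with a vector field, hence a derivation without signs. *)
- split=> [u v|c u|u v]; rewrite !comm DeltaPi.
  + exact: sbDr schouten _ u v.
  + exact: sbZr schouten c _ u.
  + exact: sb_vec_derivation schouten _ u v.
- apply: lmod_two_torsion_free; exact: sb_bivec_cocycle schouten bv Pi Pi2 PiPi.
Qed.
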